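(* Let $X$ be a Hilbert space, let $n\ge2$, and let $\Omega,\Omega_1,\dots,\Omega_n$ be nonempty closed subsets of $X$. Consider the problem $$(P)\qquad\text{minimize } D(x):=\sum_{i=1}^n d(x;\Omega_i)\quad\text{subject to }x\in\Omega .$$ For $x\in X$ put $I(x):=\{i\in\{1,\dots,n\}: x\in\Omega_i\}$ and $J(x):=\{i\in\{1,\dots,n\}: x\notin\Omega_i\}$, and define $$A_i(x):=\frac{x-\Pi(x;\Omega_i)}{d(x;\Omega_i)}\ \text{ if } x\notin\Omega_i,\qquad A_i(x):=N(x;\Omega_i)\cap\mathbb B\ \text{ if }x\in\Omega_i .$$ The following assertions hold: (i) Let $\bar x\in\Omega$ be a local optimal solution to $(P)$, and let $\Pi(\bar x;\Omega_i)\neq\emptyset$ whenever $i\in J(\bar x)$. Then for any $a_i(\bar x)\in A_i(\bar x)$, $i\in J(\bar x)$, we have $$-\sum_{i\in J(\bar x)}a_i(\bar x)\in\sum_{i\in I(\bar x)}A_i(\bar x)+N(\bar x;\Omega).\qquad( * )$$ If in addition $I(\bar x)=\emptyset$, then $$-\sum_{i=1}^n a_i(\bar x)\in\widehat N(\bar x;\Omega).$$ (ii) If all the sets $\Omega,\Omega_1,\dots,\Omega_n$ are convex and $\bar x\in\Omega$, then each set $A_i(\bar x)$ with $i\in J(\bar x)$ is a singleton $\{a_i(\bar x)\}$, and condition $( * )$ is necessary and sufficient for the global optimality of $\bar x$ in problem $(P)$.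
   Context: $d(x;Q):=\inf\{\|x-y\|:y\in Q\}$; $\Pi(x;Q):=\{w\in Q:\|x-w\|=d(x;Q)\}$ is the (possibly empty or multivalued) projection set, and $\frac{x-\Pi(x;Q)}{d(x;Q)}:=\{\frac{x-w}{d(x;Q)}: w\in\Pi(x;Q)\}$. $\mathbb B$ is the closed unit ball. The dual $X^*$ is identified with $X$. Sums of sets are Minkowski sums, and a sum over the empty index set is $0$ (or $\{0\}$). For $\varphi:X\to(-\infty,\infty]$, $\varphi(\bar x)<\infty$, $\varepsilon\ge0$, let $$\widehat\partial_\varepsilon\varphi(\bar x):=\Big\{x^*:\liminf_{x\to\bar x}\frac{\varphi(x)-\varphi(\bar x)-\langle x^*,x-\bar x\rangle}{\|x-\bar x\|}\ge-\varepsilon\Big\},\qquad \widehat\partial\varphi:=\widehat\partial_0\varphi .$$ The limiting subdifferential $\partial\varphi(\bar x)$ is the set of all $x^*$ for which there are $x_k\to\bar x$ with $\varphi(x_k)\to\varphi(\bar x)$, $\varepsilon_k\downarrow0$, and $x_k^*\in\widehat\partial_{\varepsilon_k}\varphi(x_k)$ converging weakly to $x^*$. With $\delta(\cdot;Q)$ the indicator function of $Q$, the regular (Fréchet) and limiting normal cones at $\bar x\in Q$ are $\widehat N(\bar x;Q):=\widehat\partial\delta(\bar x;Q)$ and $N(\bar x;Q):=\partial\delta(\bar x;Q)$. A point $\bar x\in\Omega$ is a local optimal solution if $D(\bar x)\le D(x)$ for all $x\in\Omega$ near $\bar x$. *)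

(* Defs.v *)
From HB Require Import structures.
From mathcomp Require Export all_boot all_order all_algebra.
From mathcomp Require Export all_classical all_reals all_analysis.
From mathcomp Require Export sesquilinear.
Export Order.TTheory GRing.Theory Num.Theory.
Export numFieldNormedType.Exports.

Set Implicit Arguments.
Unset Strict Implicit.
Unset Printing Implicit Defensive.

Local Open Scope classical_set_scope.
Local Open Scope ring_scope.

(* A real Hilbert space is represented by a complete normed module X over a
   realType R and a positive definite symmetric form ip on X such that
   ip x x = `|x| ^+ 2. Through Riesz representation, elements of X stand for
   elements of the dual: the pairing of xs with x is ip xs x. *)

Section Distance.
Context {R : realType} {X : completeNormedModType R}.
Implicit Types (Q : set X) (x w : X).

Definition dist x Q : R := inf [set `|x - y| | y in Q].

Definition proj x Q : set X := [set w | Q w /\ `|x - w| = dist x Q].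

Definition addset (A B : set X) : set X := [set a + b | a in A & b in B].

(* For s empty this is [set 0]; it is empty if some A i with i \in s is. *)
Definition sumset n (s : {set 'I_n}) (A : 'I_n -> set X) : set X :=
  [set v | exists2 w : 'I_n -> X,
     (forall i, i \in s -> A i (w i)) & v = \sum_(i in s) w i].

End Distance.

Section Subdifferentials.
Context {R : realType} {X : completeNormedModType R}.
Variable ip : {dot X for idfun}.
Implicit Types (phi : X -> \bar R) (Q : set X) (x xs : X) (eps : R).

(* Both subdifferentials are empty at points where phi is not finite. *)
Definition eps_subdiff eps phi (xbar : X) : set X :=
  [set xs | phi xbar \is a fin_num /\
    (limf_einf (fun x => (phi x - phi xbar - (ip xs (x - xbar))%:E)
                         * (`|x - xbar|^-1)%:E)%E
       (xbar^') >= (- eps)%:E)%E].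

Definition regular_subdiff phi (xbar : X) : set X := eps_subdiff 0 phi xbar.

Definition weak_cvg (xs : nat -> X) (l : X) : Prop :=
  forall v : X, (fun k => ip (xs k) v) @ \oo --> ip l v.

Definition limiting_subdiff phi (xbar : X) : set X :=
  [set xs | phi xbar \is a fin_num /\
    exists (x : nat -> X) (eps : nat -> R) (xk : nat -> X),
      [/\ x @ \oo --> xbar,
          (fun k => phi (x k)) @ \oo --> phi xbar,
          nonincreasing_seq eps /\ eps @ \oo --> (0 : R),
          forall k, 0 <= eps k /\ eps_subdiff (eps k) phi (x k) (xk k) &
          weak_cvg xk xs]].

Definition indicator_fun Q : X -> \bar R :=
  fun x => if x \in Q then 0%E else +oo%E.

Definition regular_normal_cone xbar Q : set X :=
  regular_subdiff (indicator_fun Q) xbar.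

Definition normal_cone xbar Q : set X :=
  limiting_subdiff (indicator_fun Q) xbar.

End Subdifferentials.

Section Problem.
Context {R : realType} {X : completeNormedModType R}.
Variables (n : nat) (Om : set X) (Oms : 'I_n -> set X).
Implicit Types (x : X) (i : 'I_n) (a : 'I_n -> X).

Definition cost x : R := \sum_(i < n) dist x (Oms i).

Definition local_optimal xbar : Prop :=
  Om xbar /\ \forall x \near xbar, Om x -> cost xbar <= cost x.

Definition global_optimal xbar : Prop :=
  Om xbar /\ forall x, Om x -> cost xbar <= cost x.

Definition idxI x : {set 'I_n} := [set i | x \in Oms i]%SET.

Definition idxJ x : {set 'I_n} := [set i | x \notin Oms i]%SET.

Definition Aset (ip : {dot X for idfun}) i x : set X :=
  if x \in Oms i
  then normal_cone ip x (Oms i) `&` [set v | `|v| <= 1]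
  else [set (dist x (Oms i))^-1 *: (x - w) | w in proj x (Oms i)].

Definition stationary (ip : {dot X for idfun}) a xbar : Prop :=
  addset (sumset (idxI xbar) (fun i => Aset ip i xbar)) (normal_cone ip xbar Om)
    (- \sum_(i in idxJ xbar) a i).

End Problem.

(* Main.v *)
Require Import Defs.
From mathcomp Require Import ring lra.

(** Necessity.  Let [xbar] be a local minimizer.  For a set that does not
    contain [xbar], the distance to it is bounded above, with equality at
    [xbar], by the distance to a projection of [xbar], hence by an affine
    function with slope [a_i] plus a quadratic term
    ([dist_quadratic_majorant]).  For a set that contains [xbar], the distance
    at [u] is the infimum of [|u - y_i|] over points [y_i] of the set.  So the
    point all of whose coordinates are [xbar] locally minimizes
      [<sum a_j, u - xbar> + K |u - xbar|^2 + sum_i |u - y_i|]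
    over [u] in the constraint set and [y_i] in the sets through [xbar]: the
    problem is decoupled, one variable per set.  The norms are not smooth where
    [u = y_i], so [|z|] is replaced by [sqrt (|z|^2 + mu^2)]; this costs [mu]
    per term, and Ekeland's principle moves from the approximate minimizer to a
    nearby point that is an exact minimizer up to a small multiple of the
    distance.  Varying one coordinate at a time there gives approximate normals
    [g_i] with [|g_i| <= 1], and minus the sum of all gradients in [u] as an
    approximate normal to the constraint set ([fuzzy_multipliers]).  When the
    smoothing parameter tends to 0, a subsequence of the bounded [g_i]
    converges weakly, and the limits are the multipliers
    ([exact_multipliers]).  If no set contains [xbar], the quadratic upper
    bound alone gives a regular normal ([local_optimal_regular]).

    The weak limits are found by convexity.  A diagonal argument makes the inner
    products of the members of the sequence with each other converge; the
    nested closed convex hulls of the tails have a common point because of the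
    parallelogram identity, and this point is the weak limit, first against a
    closed subspace that contains the sequence and then, by orthogonal
    projection, against every vector ([weak_cvg_gram]).

    Sufficiency.  Weakly convergent sequences are bounded, so a limiting normal
    [l] to a convex set at [x] satisfies [<l, y - x> <= 0] on the set
    ([normal_cone_convex]).  Then each [a_i] and each unit-bounded normal
    supports the corresponding distance function from below, and adding the
    supports yields global optimality ([stationary_global_optimal]). *)

Set Implicit Arguments.
Unset Strict Implicit.
Unset Printing Implicit Defensive.

Local Open Scope classical_set_scope.
Local Open Scope ring_scope.

(** * Sequences, closed sets and convex sets *)

(** Lets first-order information along a segment be extracted from an
    inequality with a quadratic remainder: divide by the step, then let the
    step tend to 0. *)
Lemma le0_of_small_multiples (R : realType) (a b : R) :
  (forall t, 0 < t -> t <= 1 -> a <= t * b) -> a <= 0.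
Proof.
move=> h; rewrite leNgt; apply/negP => a0.
have b0 : 0 < b by have := h 1 ltr01 (lexx 1); lra.
have t0 : 0 < a / (a + b) by rewrite divr_gt0//; lra.
(* Any step below [a / b] contradicts [0 < a]; this one is also at most 1. *)
have := h (a / (a + b)) t0.
rewrite ler_pdivrMr ?mul1r; last by lra.
rewrite mulrAC ler_pdivlMr; last by lra.
move=> /(_ _)/wrap[]; nra.
Qed.

Lemma seq_cvgP (R : realType) (V : normedModType R) (s : nat -> V) (l : V) :
  s @ \oo --> l <->
  forall e, 0 < e -> exists N, forall k, (N <= k)%N -> `|s k - l| <= e.
Proof.
split.
  move/cvgrPdist_le => h e e0; have [N _ HN] := h e e0.
  by exists N => k Nk; rewrite distrC; exact: HN.
move=> h; apply/cvgrPdist_le => e e0; have [N HN] := h e e0.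
by exists N => // k Nk; rewrite distrC; exact: HN.
Qed.

Lemma cauchy_cvg_seq (R : realType) (V : completeNormedModType R) (s : nat -> V) :
  (forall e, 0 < e -> exists N, forall j k, (N <= j)%N -> (N <= k)%N ->
     `|s j - s k| <= e) -> exists l : V, s @ \oo --> l.
Proof.
move=> h; suff c : cauchy (s @ \oo).
  by exists (lim (s @ \oo)); exact: cauchy_cvg.
apply: cauchy_exP => e e0.
have [N HN] := h (e / 2) (divr_gt0 e0 (ltr0n _ 2)).
exists (s N); exists N => // k Nk; rewrite -ball_normE /=.
by apply: le_lt_trans (HN _ _ _ _) _ => //; lra.
Qed.

Lemma closed_approx (R : realType) (V : normedModType R) (C : set V) x :
  closed C -> (forall e, 0 < e -> exists2 y, C y & `|x - y| <= e) -> C x.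
Proof.
move=> cC h; apply: cC => B /nbhs_normP[e /= e0 eB].
have [y Cy xy] := h (e / 2) (divr_gt0 e0 (ltr0n _ 2)).
by exists y; split=> //; apply: eB => /=; apply: le_lt_trans xy _; lra.
Qed.

Lemma approx_closed (R : realType) (V : normedModType R) (C : set V) :
  (forall x, (forall e, 0 < e -> exists2 y, C y & `|x - y| <= e) -> C x) ->
  closed C.
Proof.
move=> h x clx; apply: h => e e0.
have [|y [Cy xy]] := clx (ball x e); first exact: nbhsx_ballx.
by exists y => //; move: xy; rewrite -ball_normE /= => /ltW.
Qed.

Lemma convex_segment (R : realType) (V : lmodType R) (C : set V) x y t :
  convex_set C -> C x -> C y -> 0 <= t -> t <= 1 -> C (x + t *: (y - x)).
Proof.
move=> cC Cx Cy t0 t1.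
have := cC y x (Itv01 t0 t1); rewrite !inE => /(_ Cy Cx).
rewrite /conv/= => h; rewrite (_ : _ + _ = t *: y + (1 - t) *: x)//.
by rewrite scalerBr scalerBl scale1r; rewrite addrCA addrA.
Qed.

Lemma segment_convex (R : realType) (V : lmodType R) (C : set V) :
  (forall x y t, C x -> C y -> 0 <= t -> t <= 1 -> C (x + t *: (y - x))) ->
  convex_set C.
Proof.
move=> h x y t; rewrite !inE => Cx Cy.
have := h y x t%:num Cy Cx; rewrite ge0 le1 => /(_ isT isT).
rewrite /conv/= (_ : _ + _ = t%:num *: x + (1 - t%:num) *: y)//.
by rewrite scalerBr scalerBl scale1r; rewrite addrCA addrA.
Qed.

Lemma inv_succ_eventually_le (R : realType) (e : R) : 0 < e ->
  exists N, forall k, (N <= k)%N -> k.+1%:R^-1 <= e.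
Proof.
move=> e0; have [N HN] := (seq_cvgP _ _).1 (@cvg_harmonic R) e e0.
exists N => k Nk; have := HN k Nk.
by rewrite /harmonic/= subr0 ger0_norm// invr_ge0.
Qed.

Lemma cvg_sum (R : realType) (V : normedModType R) (I : Type) (r : seq I)
    (P : pred I) (f : I -> nat -> V) (l : I -> V) :
  (forall i, P i -> f i @ \oo --> l i) ->
  (fun k => \sum_(i <- r | P i) f i k) @ \oo --> \sum_(i <- r | P i) l i.
Proof.
move=> fl; elim: r => [|i r IHr].
  rewrite big_nil (_ : (fun _ => _) = cst 0); first exact: cvg_cst.
  by apply/funext => k; rewrite big_nil.
rewrite big_cons (_ : (fun _ => _) = (fun k => if P i
    then f i k + \sum_(j <- r | P j) f j k else \sum_(j <- r | P j) f j k)).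
  by case: ifPn => [Pi|_] //; apply: cvgD => //; exact: fl.
by apply/funext => k; rewrite big_cons.
Qed.

(** * The distance function *)

Section DistanceTheory.
Context {R : realType} {X : completeNormedModType R}.
Implicit Types (Q : set X) (x y : X).

Lemma dist_le x y Q : Q y -> dist x Q <= `|x - y|.
Proof.
move=> Qy; apply: ge_inf; last by exists y.
by exists 0 => _ [z _ <-].
Qed.

Lemma dist_glb x Q r : Q !=set0 -> (forall y, Q y -> r <= `|x - y|) ->
  r <= dist x Q.
Proof.
move=> [y Qy] h; apply: lb_le_inf; first by exists `|x - y|, y.
by move=> _ [z Qz <-]; exact: h.
Qed.

Lemma dist_approx x Q e : Q !=set0 -> 0 < e ->
  exists2 y, Q y & `|x - y| <= dist x Q + e.
Proof.
move=> Q0 e0; apply/not_exists2P => h.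
have : dist x Q + e <= dist x Q.
  apply: dist_glb => // y Qy; case: (h y) => // /negP.
  by rewrite -ltNge => /ltW.
lra.
Qed.

Lemma dist_ge0 x Q : Q !=set0 -> 0 <= dist x Q.
Proof. by move=> Q0; apply: dist_glb. Qed.

Lemma dist_mem x Q : Q x -> dist x Q = 0.
Proof.
move=> Qx; apply/eqP; rewrite eq_le dist_ge0; last by exists x.
by rewrite andbT -[leRHS](@normr0 _ X) -(subrr x) dist_le.
Qed.

Lemma dist_gt0 x Q : closed Q -> Q !=set0 -> ~ Q x -> 0 < dist x Q.
Proof.
move=> cQ Q0 nQx; rewrite lt_neqAle dist_ge0// andbT eq_sym.
apply/negP => /eqP d0; apply: nQx; apply: closed_approx => // e e0.
by have [y Qy] := dist_approx x Q0 e0; rewrite d0 add0r; exists y.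
Qed.

End DistanceTheory.

(** * Inner product inequalities *)

Section InnerProduct.
Context {R : realType} {X : completeNormedModType R}.
Variable ip : {dot X for idfun}.
Hypothesis ip_norm : forall x : X, ip x x = `|x| ^+ 2.
Implicit Types (u v w x y z : X) (C : set X).

Lemma ipC u v : ip u v = ip v u.
Proof. by have := @hermitian_subproof _ _ _ _ ip u v; rewrite expr0 mul1r. Qed.

Lemma ipDl u v w : ip (u + v) w = ip u w + ip v w.
Proof. exact: linearDl. Qed.
Lemma ipDr u v w : ip w (u + v) = ip w u + ip w v.
Proof. exact: linearDr. Qed.
Lemma ipBl u v w : ip (u - v) w = ip u w - ip v w.
Proof. exact: linearBl. Qed.
Lemma ipBr u v w : ip w (u - v) = ip w u - ip w v.
Proof. exact: linearBr. Qed.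
Lemma ipNl u w : ip (- u) w = - ip u w.
Proof. exact: linearNl. Qed.
Lemma ipNr u w : ip w (- u) = - ip w u.
Proof. exact: linearNr. Qed.
Lemma ipZr a u w : ip w (a *: u) = a * ip w u.
Proof. exact: linearZr_LR. Qed.
Lemma ipZl a u w : ip (a *: u) w = a * ip u w.
Proof. by rewrite ipC ipZr ipC. Qed.
Lemma ip0l w : ip 0 w = 0.
Proof. exact: linear0l. Qed.
Lemma ip0r w : ip w 0 = 0.
Proof. exact: linear0r. Qed.
Lemma ip_suml I (r : seq I) (P : pred I) (F : I -> X) w :
  ip (\sum_(i <- r | P i) F i) w = \sum_(i <- r | P i) ip (F i) w.
Proof. exact: linear_sumlz. Qed.

Lemma sqnormD u v : `|u + v| ^+ 2 = `|u| ^+ 2 + 2 * ip u v + `|v| ^+ 2.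
Proof. by rewrite -!ip_norm ipDl !ipDr (ipC v u); ring. Qed.

Lemma sqnormB u v : `|u - v| ^+ 2 = `|u| ^+ 2 - 2 * ip u v + `|v| ^+ 2.
Proof. by rewrite sqnormD ipNr normrN; ring. Qed.

Lemma ip_le u v : ip u v <= `|u| * `|v|.
Proof.
have [->|u0] := eqVneq u 0; first by rewrite ip0l normr0 mul0r.
have [->|v0] := eqVneq v 0; first by rewrite ip0r normr0 mulr0.
have : 0 <= `| (`|v| *: u - `|u| *: v)| ^+ 2 by rewrite sqr_ge0.
rewrite sqnormB !normrZ !normr_id ipZl ipZr => h.
have {h} : 0 <= (`|u| * `|v|) * (`|u| * `|v| - ip u v) by nra.
by rewrite pmulr_rge0 ?subr_ge0// mulr_gt0 ?normr_gt0.
Qed.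

Lemma ip_abs u v : `|ip u v| <= `|u| * `|v|.
Proof.
rewrite ler_norml ip_le andbT lerNl -ipNl.
by apply: le_trans (ip_le _ _) _; rewrite normrN.
Qed.

(** The form of the identity used to show that almost nearest points to [x] in
    a convex set are close to each other: the last norm is the distance from
    [x] to their midpoint. *)
Lemma parallelogram x y z :
  `|y - z| ^+ 2 = 2 * `|x - y| ^+ 2 + 2 * `|x - z| ^+ 2
                  - 4 * `|x - (y + 2^-1 *: (z - y))| ^+ 2.
Proof.
have -> : y - z = (x - z) - (x - y) by rewrite opprB [RHS]addrC subrKA.
have -> : x - (y + 2^-1 *: (z - y)) = 2^-1 *: ((x - z) + (x - y)).
  have -> : z - y = (x - y) - (x - z) by rewrite opprB [RHS]addrC subrKA.
  rewrite opprD addrA; move: (x - y) (x - z) => p q.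
  rewrite -{1}[p](_ : 2^-1 *: (p + p) = p).
    by rewrite -scalerBr opprB addrACA subrr addr0 addrC.
  by rewrite scalerDr -scalerDl (_ : 2^-1 + 2^-1 = 1) ?scale1r; last by field.
move: (x - y) (x - z) => p q.
rewrite normrZ exprMn sqnormB sqnormD ger0_norm; first by field.
by rewrite invr_ge0 ler0n.
Qed.

End InnerProduct.

Lemma ip_cvg (R : realType) (X : completeNormedModType R)
    (ip : {dot X for idfun}) (ip_norm : forall x : X, ip x x = `|x| ^+ 2)
    (f : nat -> X) (l v : X) :
  f @ \oo --> l -> (fun k => ip (f k) v) @ \oo --> ip l v.
Proof.
move=> fl; apply/seq_cvgP => e e0.
have v1 : 0 < `|v| + 1 by rewrite ltr_wpDl.
have [N HN] := (seq_cvgP _ _).1 fl _ (divr_gt0 e0 v1).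
exists N => k Nk; rewrite -ipBl; apply: le_trans (ip_abs ip_norm _ _) _.
have := HN k Nk; rewrite ler_pdivlMr// => h; apply: le_trans h.
by rewrite ler_wpM2l// lerDl.
Qed.

(** * Projections onto closed convex sets *)

Section Projection.
Context {R : realType} {X : completeNormedModType R}.
Variable ip : {dot X for idfun}.
Hypothesis ip_norm : forall x : X, ip x x = `|x| ^+ 2.
Implicit Types (u v w x y z : X) (C : set X).

(** If [D] is the supremum of the distances from [x] to the sets of a
    decreasing sequence, points chosen almost at distance [D] form a Cauchy
    sequence, because midpoints remain in the sets and cannot be much closer to
    [x].  The constant sequence gives projections; the tails of a bounded
    sequence give its weak limit. *)
Lemma nested_convex_nearest (C : nat -> set X) x D :
  (forall k, closed (C k)) -> (forall k, convex_set (C k)) ->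
  (forall j k, (j <= k)%N -> C k `<=` C j) ->
  (forall k e, 0 < e -> exists2 y, C k y & `|x - y| <= D + e) ->
  (forall e, 0 < e -> exists m, forall y, C m y -> D - e <= `|x - y|) ->
  exists2 y, (forall k, C k y) & `|x - y| <= D.
Proof.
move=> clC cvC decC up low.
have D0 : 0 <= D.
  apply/ler_addgt0Pr => e e0; have [y _ hy] := up 0%N e e0.
  exact: le_trans hy.
have /choice[y Hy] : forall k, exists y, C k y /\ `|x - y| <= D + k.+1%:R^-1.
  by move=> k; have [|y] := up k k.+1%:R^-1; rewrite ?invr_gt0//; exists y.
have [l yl] : exists l : X, y @ \oo --> l.
  apply: cauchy_cvg_seq => eta eta0.
  (* The parallelogram identity bounds the squared gap by
     [4 (D + e)^2 - 4 (D - e)^2 = 16 D e], or by [16 e^2] when [D < e]. *)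
  pose e := Num.min 1 (eta ^+ 2 / (16 * (D + 1))).
  have D1 : 0 < 16 * (D + 1) by lra.
  have e0 : 0 < e by rewrite lt_min ltr01 divr_gt0// exprn_gt0.
  have e1 : e <= 1 by rewrite ge_min lexx.
  have ee : 16 * e * (D + 1) <= eta ^+ 2.
    have : e <= eta ^+ 2 / (16 * (D + 1)) by rewrite ge_min lexx orbT.
    by rewrite ler_pdivlMr// => h; lra.
  have [m Hm] := low e e0; have [N HN] := inv_succ_eventually_le e0.
  exists (maxn m N) => j k; rewrite !geq_max => /andP[mj Nj] /andP[mk Nk].
  have Dj : `|x - y j| <= D + e by apply: le_trans (Hy j).2 _; rewrite lerD2l HN.
  have Dk : `|x - y k| <= D + e by apply: le_trans (Hy k).2 _; rewrite lerD2l HN.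
  have Cm : C m (y j + 2^-1 *: (y k - y j)).
    apply: convex_segment => //; [exact: decC (Hy j).1|exact: decC (Hy k).1|];
      lra.
  have := Hm _ Cm; set M := x - _ => hM.
  rewrite -(@ler_pXn2r _ 2)// ?nnegrE//; last exact: ltW.
  rewrite (parallelogram ip_norm x) -/M.
  have := normr_ge0 (x - y j); have := normr_ge0 (x - y k).
  have := normr_ge0 M; move: (`|M|) (`|x - y k|) (`|x - y j|) hM Dk Dj.
  move=> a b c hM Dk Dj a0 b0 c0.
  have b2 : b ^+ 2 <= (D + e) ^+ 2 by rewrite ler_pXn2r// nnegrE; lra.
  have c2 : c ^+ 2 <= (D + e) ^+ 2 by rewrite ler_pXn2r// nnegrE; lra.
  have a2 : (D + e) ^+ 2 - 4 * e * (D + e) <= a ^+ 2.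
    have [De|De] := leP e D; last by nra.
    have : (D - e) ^+ 2 <= a ^+ 2 by rewrite ler_pXn2r// nnegrE; lra.
    nra.
  nra.
have yl' := (seq_cvgP _ _).1 yl.
exists l.
  move=> k; apply: closed_approx (clC k) _ => e e0.
  have [N HN] := yl' e e0; exists (y (maxn k N)).
    by apply: decC (Hy _).1; exact: leq_maxl.
  by rewrite distrC; apply: HN; exact: leq_maxr.
apply/ler_addgt0Pr => e e0.
have [N HN] := yl' (e / 2) (divr_gt0 e0 (ltr0n _ 2)).
have [M HM] := inv_succ_eventually_le (divr_gt0 e0 (ltr0n R 2)).
have := HN (maxn N M) (leq_maxl _ _).
have : `|x - y (maxn N M)| <= D + e / 2.
  by apply: le_trans (Hy _).2 _; rewrite lerD2l HM// leq_maxr.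
have := ler_normD (x - y (maxn N M)) (y (maxn N M) - l); rewrite subrKA.
lra.
Qed.

Lemma proj_exists C x : closed C -> convex_set C -> C !=set0 ->
  proj x C !=set0.
Proof.
move=> clC cvC C0.
have [w Cw wD] : exists2 w, (forall k : nat, C w) & `|x - w| <= dist x C.
  apply: (@nested_convex_nearest (fun=> C)) => //.
    by move=> ? ? _ ?.
    by move=> k e e0; exact: dist_approx.
  by move=> e e0; exists 0%N => y Cy; have := dist_le x Cy; lra.
exists w; split; first exact: (Cw 0%N).
by apply/eqP; rewrite eq_le wD dist_le//; exact: (Cw 0%N).
Qed.

Lemma proj_variational C x w y : convex_set C -> proj x C w -> C y ->
  ip (x - w) (y - w) <= 0.
Proof.
move=> cvC [Cw xw] Cy.
apply: (@le0_of_small_multiples _ _ (`|y - w| ^+ 2 / 2)) => t t0 t1.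
have Cz : C (w + t *: (y - w)) by apply: convex_segment => //; exact: ltW.
have := dist_le x Cz; rewrite -xw opprD addrA.
move: (x - w) (y - w) => p q.
rewrite -(@ler_pXn2r _ 2)// ?nnegrE// (sqnormB ip_norm).
rewrite ipZr normrZ (gtr0_norm t0) exprMn => h.
rewrite -subr_ge0 -(pmulr_rge0 _ t0); move: h.
by move: (`|q| ^+ 2) (ip _ _) => a b; lra.
Qed.

Lemma proj_unique C x w w' : convex_set C -> proj x C w -> proj x C w' -> w = w'.
Proof.
move=> cvC pw pw'.
have h1 := proj_variational cvC pw pw'.1.
have h2 := proj_variational cvC pw' pw.1.
apply/eqP; rewrite eq_sym -subr_eq0 -normr_eq0 -sqrf_eq0 eq_le sqr_ge0 andbT.
rewrite -ip_norm -[X in ip X _](_ : x - w - (x - w') = _); last first.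
  by rewrite opprB addrC subrKA.
by rewrite ipBl; move: h2; rewrite -(opprB w' w) ipNr; lra.
Qed.

End Projection.

(** * Weak sequential compactness *)

(** The limit along the ultrafilter is the supremum of the levels that [f]
    exceeds on a set of the ultrafilter. *)
Lemma ultra_real_lim (R : realType) (G : set_system nat) (f : nat -> R) M :
  UltraFilter G -> (forall k, `|f k| <= M) ->
  exists c, forall e, 0 < e -> G [set k | `|f k - c| <= e].
Proof.
move=> UG fM.
have fM' k : - M <= f k <= M by rewrite -ler_norml.
pose E := [set r | G [set k | r <= f k]].
have ubE : ubound E M.
  move=> r Gr; rewrite leNgt; apply/negP => Mr.
  apply: (@filter_not_empty _ G); apply: filterS Gr => k /= rk.
  by have := fM' k; lra.
have supE : has_sup E.
  split; last by exists M.
  by exists (- M); apply: (@filterS _ G _ setT) filterT => k _ /=; case/andP: (fM' k).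
exists (sup E) => e e0.
have [r Gr er] := sup_adherent e0 supE.
have Gup : G [set k | f k < sup E + e].
  case: (in_ultra_setVsetC [set k | f k < sup E + e] UG) => // GC.
  have : E (sup E + e).
    by apply: filterS GC => k /= /negP; rewrite -leNgt.
  by move=> /(sup_upper_bound supE); lra.
apply: filterS (filterI Gr Gup) => k /= [rk kr]; rewrite ler_norml; lra.
Qed.

(** All limits are taken along one ultrafilter containing the tails, so finitely
    many approximations hold at once at arbitrarily large indices.  The bound
    [k <= phi k] preserves limits and, unlike monotonicity, lets each [phi k] be
    picked independently of the others. *)
Lemma diagonal_extraction (R : realType) (T : countType) (F : T -> nat -> R)
    (M : T -> R) :
  (forall t k, `|F t k| <= M t) ->
  exists (c : T -> R) (phi : nat -> nat), (forall k, (k <= phi k)%N) /\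
    forall t, (fun k => F t (phi k)) @ \oo --> c t.
Proof.
move=> FM; have [G [UG sG]] := ultraFilterLemma (@eventually_filter).
have /choice[c Hc] : forall t, exists c, forall e, 0 < e ->
    G [set k | `|F t k - c| <= e].
  by move=> t; exact: ultra_real_lim (FM t).
have Gn e n : 0 < e ->
    G [set k | forall t, (pickle t < n)%N -> `|F t k - c t| <= e].
  move=> e0; elim: n => [|n IHn]; first by apply: (@filterS _ G _ setT) filterT.
  have [[t tn]|nt] := pselect (exists t : T, pickle t = n).
    apply: filterS (filterI IHn (Hc t e e0)) => k /= [h1 h2] s.
    rewrite ltnS leq_eqVlt => /orP[/eqP sn|]; last exact: h1.
    suff -> : s = t by [].
    by apply: (pcan_inj (@pickleK T)); rewrite sn tn.
  apply: filterS IHn => k /= h s; rewrite ltnS leq_eqVlt => /orP[/eqP sn|]; last exact: h.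
  by case: nt; exists s.
have /choice[phi Hphi] : forall k, exists j, (k <= j)%N /\
    forall t, (pickle t < k)%N -> `|F t j - c t| <= k.+1%:R^-1.
  move=> k; have k0 : 0 < k.+1%:R^-1 :> R by rewrite invr_gt0.
  have Gk : G [set j | (k <= j)%N] by apply: sG; exists k.
  have [j [h1 h2]] := filter_ex (filterI Gk (Gn _ k k0)).
  by exists j.
exists c, phi; split=> [k|t]; first by have [] := Hphi k.
apply/seq_cvgP => e e0; have [N HN] := inv_succ_eventually_le e0.
exists (maxn N (pickle t).+1) => k; rewrite geq_max => /andP[Nk tk].
by apply: le_trans ((Hphi k).2 t tk) _; exact: HN.
Qed.

Section WeakCompactness.
Context {R : realType} {X : completeNormedModType R}.
Variable ip : {dot X for idfun}.
Hypothesis ip_norm : forall x : X, ip x x = `|x| ^+ 2.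
Implicit Types (u v w x y z : X) (C : set X).

Lemma closed_ball_convex B : closed [set x : X | `|x| <= B] /\
  convex_set [set x : X | `|x| <= B].
Proof.
split.
  apply: approx_closed => x h; apply/ler_addgt0Pr => e e0.
  have [y /= yB xy] := h e e0; have := ler_normD (x - y) y.
  by rewrite subrK; lra.
apply: segment_convex => x y t /= xB yB t0 t1.
have -> : x + t *: (y - x) = (1 - t) *: x + t *: y.
  by rewrite scalerBr scalerBl scale1r addrA addrAC.
apply: le_trans (ler_normD _ _) _; rewrite !normrZ !ger0_norm//; last by lra.
nra.
Qed.

Lemma closed_slab_convex v c e : closed [set x : X | `|ip x v - c| <= e] /\
  convex_set [set x : X | `|ip x v - c| <= e].
Proof.
split.
  apply: approx_closed => x h; apply/ler_addgt0Pr => d d0.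
  have v1 : 0 < `|v| + 1 by rewrite ltr_wpDl.
  have [y /= yB xy] := h (d / (`|v| + 1)) (divr_gt0 d0 v1).
  have := ip_abs ip_norm (x - y) v; rewrite ipBl => hxy.
  have : `|x - y| * `|v| <= d.
    move: xy; rewrite ler_pdivlMr// => xy; apply: le_trans xy.
    by rewrite mulrDr mulr1 lerDl.
  have := ler_normD (ip x v - ip y v) (ip y v - c); rewrite subrKA; lra.
apply: segment_convex => x y t /= xB yB t0 t1.
move: xB yB; rewrite ipDl ipZl ipBl// !ler_norml => /andP[? ?] /andP[? ?].
nra.
Qed.

(** Boundedness makes the supremum of the distances from 0 finite, and nearly
    nearest points to 0 then converge to a common point.  In a Hilbert space
    this expresses the weak compactness of bounded closed convex sets. *)
Lemma nested_bounded_convex (C : nat -> set X) B :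
  (forall k, closed (C k)) -> (forall k, convex_set (C k)) ->
  (forall j k, (j <= k)%N -> C k `<=` C j) ->
  (forall k, exists2 x, C k x & `|x| <= B) ->
  exists x, forall k, C k x.
Proof.
move=> clC cvC decC C0.
have C0' k : C k !=set0 by have [x Cx _] := C0 k; exists x.
pose E := range (fun k => dist 0 (C k)).
have supE : has_sup E.
  split; first by exists (dist 0 (C 0%N)), 0%N.
  exists B => _ [k _ <-]; have [x Cx xB] := C0 k.
  by apply: le_trans (dist_le 0 Cx) _; rewrite sub0r normrN.
have [x Cx _] : exists2 x, (forall k, C k x) & `|0 - x| <= sup E.
  apply: (nested_convex_nearest ip_norm) => //.
    move=> k e e0; have [y Cy hy] := dist_approx 0 (C0' k) e0.
    exists y => //; apply: le_trans hy _; rewrite lerD2r.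
    by apply: sup_upper_bound => //; exists k.
  move=> e e0; have [_ [k _ <-] hk] := sup_adherent e0 supE.
  by exists k => y Cy; have := dist_le 0 Cy; lra.
by exists x.
Qed.

(** The candidate limit is a common point of the closed convex hulls of all
    tails.  It lies in every closed convex set that contains a tail; applied to
    thin slabs, this identifies its inner products with the members of the
    sequence. *)
Lemma weak_cvg_gram (h : nat -> X) B (c : nat -> R) :
  (forall k, `|h k| <= B) ->
  (forall m, (fun k => ip (h k) (h m)) @ \oo --> c m) ->
  exists2 p, `|p| <= B & weak_cvg ip h p.
Proof.
move=> hB hc.
(* The closed convex hull of the tail from [m] on. *)
pose hull m : set X := fun x => forall C, closed C -> convex_set C ->
  (forall k, (m <= k)%N -> C (h k)) -> C x.
have hull_h m k : (m <= k)%N -> hull m (h k) by move=> mk C _ _; apply.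
have [p Hp] : exists p, forall m, hull m p.
  apply: (@nested_bounded_convex _ B).
  - move=> m x clx C clC cvC hC; apply: (clC) => U Ux.
    by have [y [Hy Uy]] := clx U Ux; exists y; split=> //; exact: (Hy _ clC cvC hC).
  - move=> m; apply: segment_convex => x y t Hx Hy t0 t1 C clC cvC hC.
    by apply: convex_segment => //; [exact: (Hx _ clC cvC hC)|exact: (Hy _ clC cvC hC)].
  - move=> j k jk x Hx C clC cvC hC; apply: Hx => // i ki.
    by apply: hC; exact: leq_trans ki.
  - by move=> k; exists (h k) => //; exact: hull_h.
have pB : `|p| <= B.
  have [clB cvB] := closed_ball_convex B.
  by apply: (Hp 0%N _ clB cvB) => k _ /=.
have pc m : ip p (h m) = c m.
  apply/eqP; rewrite -subr_eq0 -normr_le0; apply/ler_addgt0Pr => e e0.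
  rewrite add0r; have [N HN] := (seq_cvgP _ _).1 (hc m) e e0.
  have [cls cvs] := closed_slab_convex (h m) (c m) e.
  by apply: (Hp N _ cls cvs) => k Nk /=; exact: HN.
(* The vectors against which the convergence holds: a closed subspace that
   contains the sequence and its candidate limit.  What remains of a vector
   after projection on it is orthogonal to the sequence. *)
pose V : set X := [set v | (fun k => ip (h k - p) v) @ \oo --> (0 : R)].
have Vlin v w t : V v -> V w -> V (v + t *: w).
  move=> Vv Vw; rewrite /V/= -(addr0 0) -[X in _ --> _ + X](mulr0 t).
  have -> : (fun k => ip (h k - p) (v + t *: w)) =
            (fun k => ip (h k - p) v + t * ip (h k - p) w).
    by apply/funext => k; rewrite ipDr ipZr.
  by apply: cvgD => //; exact: cvgMl_tmp.
have hpB k : `|h k - p| <= 2 * B.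
  by have := ler_normB (h k) p; have := hB k; lra.
have clV : closed V.
  apply: approx_closed => v appr; apply/seq_cvgP => e e0.
  have B0 : 0 <= B by exact: le_trans pB.
  have K0 : 0 < 4 * B + 1 by lra.
  have [w Vw vw] := appr (e / (4 * B + 1)) (divr_gt0 e0 K0).
  have [N HN] := (seq_cvgP _ _).1 Vw (e / 2) (divr_gt0 e0 (ltr0n _ 2)).
  exists N => k Nk; rewrite subr0; have := HN k Nk; rewrite subr0 => hw.
  have := ip_abs ip_norm (h k - p) (v - w); rewrite ipBr.
  have := ler_normD (ip (h k - p) v - ip (h k - p) w) (ip (h k - p) w).
  rewrite subrK.
  have : `|h k - p| * `|v - w| <= 2 * B * (e / (4 * B + 1)).
    by apply: ler_pM.
  have : 2 * B * (e / (4 * B + 1)) <= e / 2.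
    by rewrite mulrA ler_pdivrMr//; nra.
  lra.
have cvV : convex_set V.
  apply: segment_convex => x y t Vx Vy _ _.
  apply: (Vlin) => //; rewrite -scaleN1r; exact: Vlin.
have Vh m : V (h m).
  rewrite /V/= -(subrr (c m)) -{2}pc.
  have -> : (fun k => ip (h k - p) (h m)) =
            (fun k => ip (h k) (h m) - ip p (h m)).
    by apply/funext => k; rewrite ipBl.
  by apply: cvgB => //; exact: cvg_cst.
have Vp : V p by apply: (Hp 0%N).
exists p => // v.
have [w [Vw vw]] : proj v V !=set0.
  by apply: (proj_exists ip_norm) => //; exists p.
have orth k : ip (h k - p) (v - w) = 0.
  have Vhp : V (h k - p) by rewrite -scaleN1r; exact: Vlin.
  apply/eqP; rewrite eq_le ipC; apply/andP; split.
    have Vy : V (w + 1 *: (h k - p)) by exact: Vlin.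
    have := proj_variational ip_norm cvV (conj Vw vw) Vy.
    by rewrite scale1r [w + _]addrC addrK.
  have Vy : V (w + -1 *: (h k - p)) by exact: Vlin.
  have := proj_variational ip_norm cvV (conj Vw vw) Vy.
  by rewrite scaleN1r [w + _]addrC addrK ipNr oppr_le0.
apply/subr_cvg0.
rewrite (_ : (fun _ => _) = (fun k => ip (h k - p) w)); first exact: Vw.
by apply/funext => k; rewrite -ipBl -[v in LHS](subrK w) ipDr orth add0r.
Qed.

Theorem weak_sequential_compactness (I : finType) (g : I -> nat -> X) B :
  (forall i k, `|g i k| <= B) ->
  exists (p : I -> X) (phi : nat -> nat), (forall k, (k <= phi k)%N) /\
    forall i, `|p i| <= B /\ weak_cvg ip (fun k => g i (phi k)) (p i).
Proof.
move=> gB.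
have [|c [phi [phik Hc]]] := @diagonal_extraction R (I * nat)%type
   (fun t k => ip (g t.1 k) (g t.1 t.2)) (fun=> B * B).
  move=> [i m] k /=; apply: le_trans (ip_abs ip_norm _ _) _.
  by rewrite ler_pM.
have /choice[p Hp] : forall i, exists p, `|p| <= B /\
    weak_cvg ip (fun k => g i (phi k)) p.
  move=> i; have [||p] := @weak_cvg_gram (fun k => g i (phi k)) B
    (fun m => c (i, phi m)).
  - by move=> k.
  - by move=> m; exact: (Hc (i, phi m)).
  - by exists p.
by exists p, phi.
Qed.

End WeakCompactness.

(** * Ekeland's variational principle *)

(** The principle is stated for a pseudo-distance and without a topology, so
    that it applies to products in which only finitely many coordinates
    count. *)
Section Ekeland.
Context {R : realType} {T : Type}.
Variables (rho : T -> T -> R) (C : set T) (f : T -> R) (m lam : R).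
Hypothesis rho_refl : forall x, rho x x = 0.
Hypothesis rho_sym : forall x y, rho x y = rho y x.
Hypothesis rho_tri : forall x y z, rho x z <= rho x y + rho y z.
Hypothesis complete : forall s : nat -> T, (forall k, C (s k)) ->
  (forall e, 0 < e -> exists N, forall j k, (N <= j)%N -> (N <= k)%N ->
     rho (s j) (s k) <= e) ->
  exists2 l, C l & forall e, 0 < e -> exists N, forall k, (N <= k)%N ->
     rho (s k) l <= e.
Hypothesis lsc : forall l, C l -> forall e, 0 < e ->
  exists2 d, 0 < d & forall y, C y -> rho y l <= d -> f l <= f y + e.
Hypothesis f_lb : forall x, C x -> m <= f x.
Hypothesis lam_gt0 : 0 < lam.

(** The points reached from [x] with an average descent rate of at least
    [lam]; this is a preorder on feasible points. *)
Let below x : set T := [set y | C y /\ f y + lam * rho x y <= f x].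

Let below_trans x y z : below x y -> below y z -> below x z.
Proof.
move=> [_ xy] [Cz yz]; split=> //.
by have := ler_wpM2l (ltW lam_gt0) (rho_tri x y z); rewrite mulrDr; lra.
Qed.

Let almost_min x e : C x -> 0 < e ->
  exists2 y, below x y & forall z, below x z -> f y <= f z + e.
Proof.
move=> Cx e0.
have Bx : below x x by split=> //; rewrite rho_refl mulr0 addr0.
have infB : has_inf (f @` below x).
  by split; [exists (f x), x|exists m => _ [y [Cy _] <-]; exact: f_lb].
have [_ [y By <-] hy] := inf_adherent e0 infB.
exists y => // z Bz; apply: le_trans (ltW hy) _; rewrite lerD2r.
by apply: ge_inf; [exact: infB.2|exists z].
Qed.

(** Each step nearly minimizes [f] over what is reachable from the current
    point.  The total descent is bounded, so the steps converge; whatever is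
    reachable from the limit is reachable from every step, and hence cannot
    have a smaller value than the limit. *)
Theorem ekeland x0 : C x0 ->
  exists2 x, C x & f x + lam * rho x0 x <= f x0 /\
    forall y, C y -> f x <= f y + lam * rho x y.
Proof.
move=> Cx0.
have rho_ge0 x y : 0 <= rho x y.
  by have := rho_tri x y x; rewrite rho_refl (rho_sym y x); lra.
have /choice[step Hstep] : forall kx : nat * T, exists y, C kx.2 ->
    below kx.2 y /\ forall z, below kx.2 z -> f y <= f z + kx.1.+1%:R^-1.
  move=> [k x]; have [Cx|nCx] := pselect (C x); last by exists x.
  have [|y h1 h2] := @almost_min x k.+1%:R^-1 Cx; first by rewrite invr_gt0.
  by exists y.
pose s := fix s k := if k is k'.+1 then step (k', s k') else x0.
have Cs k : C (s k).
  by elim: k => [//|k IHk]; have [[]] := Hstep (k, s k) IHk.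
have s_below j k : (j <= k)%N -> below (s j) (s k).
  elim: k => [|k IHk].
    by rewrite leqn0 => /eqP ->; split=> //; rewrite rho_refl mulr0 addr0.
  rewrite leq_eqVlt => /orP[/eqP ->|].
    by split=> //; rewrite rho_refl mulr0 addr0.
  rewrite ltnS => /IHk /below_trans; apply.
  by have [] := Hstep (k, s k) (Cs k).
have [x Cx sx] : exists2 l, C l & forall e, 0 < e -> exists N, forall k,
    (N <= k)%N -> rho (s k) l <= e.
  apply: complete => // e e0.
  have infS : has_inf (range (f \o s)).
    by split; [exists (f x0), 0%N|exists m => _ [k _ <-]; exact: f_lb].
  have e1 : 0 < lam * (e / 2) by rewrite mulr_gt0// divr_gt0.
  have [_ [N _ <-]] := inf_adherent e1 infS; rewrite [(f \o s) N]/= => hN.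
  have near_sN k : (N <= k)%N -> rho (s N) (s k) <= e / 2.
    move=> Nk; have [_ hk] := s_below _ _ Nk.
    have hinf : inf (range (f \o s)) <= f (s k).
      by apply: ge_inf; [exact: infS.2|exists k].
    by rewrite -(ler_pM2l lam_gt0); lra.
  exists N => j k /near_sN hj /near_sN hk.
  by have := rho_tri (s j) (s N) (s k); rewrite (rho_sym (s j) (s N)); lra.
have x_below k : below (s k) x.
  split=> //; apply/ler_addgt0Pr => e e0.
  have l1 : 0 < 1 + lam by rewrite ltr_pDl.
  have e1 : 0 < e / (1 + lam) by rewrite divr_gt0.
  have [d d0 hd] := lsc Cx e1.
  have [N1 hN1] := sx _ d0; have [N2 hN2] := sx _ e1.
  pose j := maxn k (maxn N1 N2).
  have kj : (k <= j)%N by exact: leq_maxl.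
  have N1j : (N1 <= j)%N by rewrite /j maxnCA leq_maxl.
  have N2j : (N2 <= j)%N by rewrite /j maxnA leq_maxr.
  have h1 := hd _ (Cs j) (hN1 j N1j); have h2 := hN2 j N2j.
  have [_ h3] := s_below _ _ kj; have h4 := rho_tri (s k) (s j) x.
  have : e = (1 + lam) * (e / (1 + lam)) by rewrite mulrC divfK// gt_eqF.
  move: (e / _) h1 h2 => e' h1 h2 ->; move: lam_gt0 => lam0; nra.
exists x => //; split; first exact: (x_below 0%N).2.
move=> y Cy; rewrite leNgt; apply/negP => yx.
have y_below k : below (s k) y
  by apply: below_trans (x_below k) _; split=> //; exact: ltW.
have : f x <= f y.
  apply/ler_addgt0Pr => e e0; have [N hN] := inv_succ_eventually_le e0.
  have [_ /(_ y (y_below N)) h1] := Hstep (N, s N) (Cs N).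
  have [_ h2] := x_below N.+1; have := rho_ge0 (s N.+1) x; have := hN N (leqnn N).
  move: h1 => /=; rewrite -/(s N.+1); move: (_^-1) => d; move: lam_gt0 => lam0; nra.
by move: lam_gt0 => lam0; have := rho_ge0 x y; nra.
Qed.

End Ekeland.

(** * Approximate normals *)

Section Normals.
Context {R : realType} {X : completeNormedModType R}.
Variable ip : {dot X for idfun}.
Implicit Types (Q : set X) (x xs y : X) (eps : R).

Let quotient_mem Q x xs y : Q x -> Q y ->
  ((indicator_fun Q y - indicator_fun Q x - (ip xs (y - x))%:E)
     * (`|y - x|^-1)%:E = (- (ip xs (y - x) / `|y - x|))%:E)%E.
Proof.
move=> Qx Qy; rewrite /indicator_fun !mem_set//.
by rewrite sube0 sub0e -EFinN -EFinM mulNr.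
Qed.

(** Off the set the difference quotient of the indicator function is
    infinite, so only points of the set constrain [xs]. *)
Lemma eps_normal_intro eps Q x xs : Q x ->
  (forall e, 0 < e -> \forall y \near x, Q y ->
     ip xs (y - x) <= (eps + e) * `|y - x|) ->
  eps_subdiff ip eps (indicator_fun Q) x xs.
Proof.
move=> Qx h; split; first by rewrite /indicator_fun mem_set.
rewrite limf_einfE; apply/lee_addgt0Pr => e e0.
rewrite -leeBlDr// -EFinB; apply: le_ereal_sup_tmp.
set phi := fun y => _.
pose V : set X := [set y | y != x /\ (Q y ->
  ip xs (y - x) <= (eps + e) * `|y - x|)].
exists (ereal_inf (phi @` V)).
  exists V => //; near=> y; split; first by near: y; exact: nbhs_dnbhs_neq.
  by near: y; apply: cvg_within; exact: h.
apply: le_ereal_inf_tmp => _ [y [yx hy] <-].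
have yx0 : 0 < `|y - x| by rewrite normr_gt0 subr_eq0.
have [Qy|nQy] := pselect (Q y).
  rewrite /phi quotient_mem// lee_fin -opprD lerN2 ler_pdivrMr//.
  exact: hy.
rewrite /phi /indicator_fun (mem_set Qx) memNset// sube0.
by rewrite addye// gt0_mulye ?leey// lte_fin invr_gt0.
Unshelve. all: by end_near. Qed.

Lemma eps_normal_elim eps Q x xs :
  eps_subdiff ip eps (indicator_fun Q) x xs ->
  Q x /\ (forall e, 0 < e -> \forall y \near x, Q y ->
     ip xs (y - x) <= (eps + e) * `|y - x|).
Proof.
move=> [fin]; have Qx : Q x.
  by move: fin; rewrite /indicator_fun; case: ifPn => // /set_mem.
rewrite limf_einfE => h; split=> // e e0.
have lt : ((- eps - e)%:E < (- eps)%:E :> \bar R)%E by rewrite lte_fin; lra.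
have [_ [V xV <-] hV] := ereal_sup_gt (lt_le_trans lt h).
rewrite /dnbhs/within/= in xV.
apply: filterS xV => y hy Qy.
have [->|yx] := eqVneq y x; first by rewrite !subrr normr0 ip0r mulr0.
have yx0 : 0 < `|y - x| by rewrite normr_gt0 subr_eq0.
have := ereal_inf_lbound (imageP (fun y => ((indicator_fun Q y -
  indicator_fun Q x - (ip xs (y - x))%:E) * (`|y - x|^-1)%:E)%E) (hy yx)).
move=> /(lt_le_trans hV); rewrite quotient_mem// lte_fin -opprD ltrN2.
by rewrite ltr_pdivrMr// => /ltW.
Qed.

(** Exact minimization of a function with a quadratic upper model produces
    inequalities of this shape; the quadratic term vanishes in the limit. *)
Lemma eps_normal_quadratic eps Q x xs c r : Q x -> 0 < r ->
  (forall y, Q y -> `|y - x| <= r ->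
     ip xs (y - x) <= eps * `|y - x| + c * `|y - x| ^+ 2) ->
  eps_subdiff ip eps (indicator_fun Q) x xs.
Proof.
move=> Qx r0 h; apply: eps_normal_intro => // e e0.
have c1 : 0 < `|c| + 1 by rewrite ltr_wpDl.
near=> y => Qy.
have yr : `|y - x| <= r.
  by near: y; apply: cvgr_distC_le => //; exact: cvg_id.
have ye : `|y - x| <= e / (`|c| + 1).
  by near: y; apply: cvgr_distC_le; [exact: cvg_id|exact: divr_gt0].
apply: le_trans (h y Qy yr) _.
rewrite mulrDl lerD2l expr2 mulrA ler_wpM2r//.
move: ye; rewrite ler_pdivlMr// => ye; apply: le_trans ye.
by have := ler_norm c; have := normr_ge0 (y - x); nra.
Unshelve. all: by end_near. Qed.

Lemma eps_normal_le eps eps' Q x xs : eps <= eps' ->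
  eps_subdiff ip eps (indicator_fun Q) x xs ->
  eps_subdiff ip eps' (indicator_fun Q) x xs.
Proof.
move=> le_eps [fin h]; split=> //; apply: le_trans h.
by rewrite lee_fin lerN2.
Qed.

(** Along a segment inside a convex set both sides are homogeneous in the step,
    so the local inequality extends to the whole set. *)
Lemma eps_normal_convex eps Q x xs y : convex_set Q ->
  eps_subdiff ip eps (indicator_fun Q) x xs -> Q y ->
  ip xs (y - x) <= eps * `|y - x|.
Proof.
move=> cvQ /eps_normal_elim[Qx h] Qy.
have [->|yx] := eqVneq y x; first by rewrite !subrr normr0 ip0r mulr0.
have yx0 : 0 < `|y - x| by rewrite normr_gt0 subr_eq0.
apply/ler_addgt0Pr => e e0.
have [d /= d0 hd] := (nbhs_normP _ _).1 (h (e / `|y - x|) (divr_gt0 e0 yx0)).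
pose t := Num.min 1 (d / 2 / `|y - x|).
have t0 : 0 < t by rewrite lt_min ltr01 !divr_gt0.
have t1 : t <= 1 by rewrite ge_min lexx.
have td : t * `|y - x| < d.
  have : t <= d / 2 / `|y - x| by rewrite ge_min lexx orbT.
  by rewrite ler_pdivlMr//; lra.
have Qz : Q (x + t *: (y - x)) by apply: convex_segment => //; exact: ltW.
have := hd (x + t *: (y - x)); rewrite /= opprD addNKr normrN normrZ gtr0_norm//.
move=> /(_ td Qz); rewrite addrAC subrr add0r ipZr normrZ gtr0_norm//.
rewrite mulrCA ler_pM2l// mulrDl divfK// gt_eqF//.
Qed.

End Normals.

Lemma limiting_normal_intro (R : realType) (X : completeNormedModType R)
    (ip : {dot X for idfun}) (Q : set X) (xbar : X) (x g : nat -> X) (l : X) :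
  Q xbar -> x @ \oo --> xbar ->
  (forall k, eps_subdiff ip k.+1%:R^-1 (indicator_fun Q) (x k) (g k)) ->
  weak_cvg ip g l -> normal_cone ip xbar Q l.
Proof.
move=> Qx xx gk gl; split; first by rewrite /indicator_fun mem_set.
exists x, (fun k => k.+1%:R^-1), g; split=> //.
- rewrite (_ : (fun k => _) = cst (indicator_fun Q xbar)); first exact: cvg_cst.
  apply/funext => k; have [Qxk _] := eps_normal_elim (gk k).
  by rewrite /indicator_fun !mem_set.
- split; last exact: cvg_harmonic.
  by move=> j k jk; rewrite lef_pV2 ?posrE// ler_nat ltnS.
Qed.

(** * A smooth majorant of the norm *)

Section SmoothNorm.
Context {R : realType} {X : completeNormedModType R}.
Variable ip : {dot X for idfun}.
Hypothesis ip_norm : forall x : X, ip x x = `|x| ^+ 2.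
Variable mu : R.
Hypothesis mu_gt0 : 0 < mu.
Implicit Types z w : X.

Definition smooth_norm z : R := Num.sqrt (`|z| ^+ 2 + mu ^+ 2).

Lemma smooth_norm_sqr z : smooth_norm z ^+ 2 = `|z| ^+ 2 + mu ^+ 2.
Proof. by rewrite sqr_sqrtr// addr_ge0 ?sqr_ge0. Qed.

Lemma smooth_norm_ge_mu z : mu <= smooth_norm z.
Proof.
rewrite -(@ler_pXn2r _ 2)// ?nnegrE ?sqrtr_ge0 ?(ltW mu_gt0)//.
by rewrite smooth_norm_sqr lerDr sqr_ge0.
Qed.

Lemma smooth_norm_ge z : `|z| <= smooth_norm z.
Proof.
rewrite -(@ler_pXn2r _ 2)// ?nnegrE ?sqrtr_ge0//.
by rewrite smooth_norm_sqr lerDl sqr_ge0.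
Qed.

Lemma smooth_norm0 : smooth_norm 0 = mu.
Proof. by rewrite /smooth_norm normr0 expr0n add0r sqrtr_sqr gtr0_norm. Qed.

Lemma smooth_norm_lipschitz z w : smooth_norm z <= smooth_norm w + `|z - w|.
Proof.
rewrite -(@ler_pXn2r _ 2)// ?nnegrE ?addr_ge0 ?sqrtr_ge0//.
rewrite sqrrD !smooth_norm_sqr.
have := smooth_norm_ge w; have := ler_normD (z - w) w; rewrite subrK.
have := normr_ge0 z; have := normr_ge0 w; have := normr_ge0 (z - w).
nra.
Qed.

Definition smooth_grad z : X := (smooth_norm z)^-1 *: z.

Lemma smooth_grad_le1 z : `|smooth_grad z| <= 1.
Proof.
have s0 : 0 < smooth_norm z by exact: lt_le_trans (smooth_norm_ge_mu z).
rewrite normrZ normfV (gtr0_norm s0) mulrC ler_pdivrMr// mul1r.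
exact: smooth_norm_ge.
Qed.

(** From [t <= s + (t^2 - s^2) / (2 s)] for [s > 0], applied to the two
    smoothed norms: the difference of their squares is that of [|w|^2] and
    [|z|^2].  The denominator is at least [2 mu]. *)
Lemma smooth_norm_upper z w :
  smooth_norm w <= smooth_norm z + ip (smooth_grad z) (w - z)
                   + (2 * mu)^-1 * `|w - z| ^+ 2.
Proof.
have s0 : 0 < smooth_norm z by exact: lt_le_trans (smooth_norm_ge_mu z).
rewrite /smooth_grad ipZl.
have hw : `|w| ^+ 2 = `|z| ^+ 2 + 2 * ip z (w - z) + `|w - z| ^+ 2.
  by rewrite -(sqnormD ip_norm) addrC subrK.
have h : smooth_norm w <= smooth_norm z + (smooth_norm z)^-1 * ip z (w - z)
                   + (2 * smooth_norm z)^-1 * `|w - z| ^+ 2.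
  have -> : smooth_norm z + (smooth_norm z)^-1 * ip z (w - z)
      + (2 * smooth_norm z)^-1 * `|w - z| ^+ 2 =
      (2 * smooth_norm z ^+ 2 + 2 * ip z (w - z) + `|w - z| ^+ 2)
      / (2 * smooth_norm z) by field; rewrite gt_eqF.
  rewrite ler_pdivlMr; last by lra.
  have := smooth_norm_sqr w; have := smooth_norm_sqr z; rewrite hw.
  have := sqr_ge0 (smooth_norm w - smooth_norm z).
  nra.
apply: le_trans h _; rewrite lerD2l ler_wpM2r ?sqr_ge0//.
by rewrite lef_pV2 ?posrE ?mulr_gt0// ler_pM2l// smooth_norm_ge_mu.
Qed.

End SmoothNorm.

(** * Multipliers for decoupled minimization *)

(** The hypothesis [decoupled_min] states that the point with all coordinates
    equal to [xbar], where the expression vanishes, is minimal while [u] moves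
    in the constraint set near [xbar] and, independently, each [y i] moves in
    its own set. *)
Section Multipliers.
Context {R : realType} {X : completeNormedModType R}.
Variable ip : {dot X for idfun}.
Hypothesis ip_norm : forall x : X, ip x x = `|x| ^+ 2.
Variables (I : finType) (s : {set I}) (Q : I -> set X) (Om : set X) (xbar : X).
Variables (A : X) (K r : R).
Hypothesis Om_closed : closed Om.
Hypothesis Q_closed : forall i, closed (Q i).
Hypothesis Om_xbar : Om xbar.
Hypothesis Q_xbar : forall i, i \in s -> Q i xbar.
Hypothesis K_ge0 : 0 <= K.
Hypothesis r_gt0 : 0 < r.
Hypothesis decoupled_min : forall u y, Om u -> `|u - xbar| <= r ->
  (forall i, i \in s -> Q i (y i)) ->
  0 <= ip A (u - xbar) + K * `|u - xbar| ^+ 2 + \sum_(i in s) `|u - y i|.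

Let T := (X * (I -> X))%type.

Let rho (p q : T) : R := `|p.1 - q.1| + \sum_(i in s) `|p.2 i - q.2 i|.

Let feasible : set T := [set p | [/\ Om p.1, `|p.1 - xbar| <= r &
  forall i, i \in s -> Q i (p.2 i)]].

Let rho_refl p : rho p p = 0.
Proof.
rewrite /rho subrr normr0 add0r big1// => i _.
by rewrite subrr normr0.
Qed.

Let rho_sym p q : rho p q = rho q p.
Proof.
by rewrite /rho distrC; congr (_ + _); apply: eq_bigr => i _; rewrite distrC.
Qed.

Let rho_tri p q o : rho p o <= rho p q + rho q o.
Proof.
rewrite /rho addrACA -big_split/=; apply: lerD; first exact: ler_distD.
by apply: ler_sum => i _; exact: ler_distD.
Qed.

Let rho_fst p q : `|p.1 - q.1| <= rho p q.
Proof. by rewrite lerDl sumr_ge0. Qed.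

Let rho_snd p q i : i \in s -> `|p.2 i - q.2 i| <= rho p q.
Proof.
move=> si; rewrite /rho (bigD1 i)//= addrCA lerDl.
by rewrite addr_ge0// sumr_ge0.
Qed.

Let rho_complete (t : nat -> T) : (forall k, feasible (t k)) ->
  (forall e, 0 < e -> exists N, forall j k, (N <= j)%N -> (N <= k)%N ->
     rho (t j) (t k) <= e) ->
  exists2 l, feasible l & forall e, 0 < e -> exists N, forall k, (N <= k)%N ->
     rho (t k) l <= e.
Proof.
move=> Ct cau.
have [u tu] : exists u : X, (fun k => (t k).1) @ \oo --> u.
  apply: cauchy_cvg_seq => e e0; have [N HN] := cau e e0.
  by exists N => j k Nj Nk; apply: le_trans (rho_fst _ _) _; exact: HN.
have /choice[y ty] : forall i, exists yi : X, i \in s ->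
    (fun k => (t k).2 i) @ \oo --> yi.
  move=> i; have [si|si] := boolP (i \in s); last by exists 0.
  have [yi tyi] : exists yi : X, (fun k => (t k).2 i) @ \oo --> yi.
    apply: cauchy_cvg_seq => e e0; have [N HN] := cau e e0.
    by exists N => j k Nj Nk; apply: le_trans (rho_snd _ _ si) _; exact: HN.
  by exists yi.
have rho_cvg : (fun k => rho (t k) (u, y)) @ \oo --> 0.
  rewrite [X in _ --> X](_ : 0 = 0 + \sum_(i in s) 0); last first.
    by rewrite big1_eq addr0.
  have n0 (f : nat -> X) l : f @ \oo --> l -> (fun k => `|f k - l|) @ \oo --> 0.
    by move=> fl; rewrite -(@normr0 _ X); apply: cvg_norm; exact/subr_cvg0.
  apply: cvgD; first exact: n0 tu.
  apply: cvg_sum => i si; exact: n0 (ty i si).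
have rho_cvg' := (seq_cvgP _ _).1 rho_cvg.
exists (u, y); last first.
  move=> e e0; have [N HN] := rho_cvg' e e0; exists N => k Nk.
  by have := HN k Nk; rewrite subr0; apply: le_trans; exact: ler_norm.
have approx e : 0 < e -> exists k, rho (t k) (u, y) <= e.
  move=> e0; have [N HN] := rho_cvg' e e0; exists N.
  by have := HN N (leqnn N); rewrite subr0; apply: le_trans; exact: ler_norm.
split=> /=.
- apply: closed_approx Om_closed _ => e e0; have [k hk] := approx e e0.
  exists (t k).1; first by have [] := Ct k.
  by rewrite distrC; apply: le_trans hk; exact: (rho_fst _ (u, y)).
- apply/ler_addgt0Pr => e e0; have [k hk] := approx e e0.
  have [_ h _] := Ct k; have := rho_fst (t k) (u, y) => /=.
  by have := ler_distD (t k).1 u xbar; rewrite (distrC u (t k).1); lra.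
- move=> i si; apply: (closed_approx (@Q_closed i)) => e e0.
  have [k hk] := approx e e0.
  exists ((t k).2 i); first by have [_ _] := Ct k; exact.
  by rewrite distrC; apply: le_trans hk; exact: (rho_snd _ (u, y)).
Qed.

Section Fuzzy.
Variable lam : R.
Hypothesis lam_gt0 : 0 < lam.
(* With smoothing parameter [lam ^ 2] the starting point is minimal up to a
   multiple of [lam ^ 2], so Ekeland's point for the slope [lam] is at distance
   of order [lam]. *)
Let mu := lam ^+ 2.
Let mu_gt0 : 0 < mu. Proof. by rewrite exprn_gt0. Qed.

Let objective (p : T) : R := ip A (p.1 - xbar) + K * `|p.1 - xbar| ^+ 2
  + \sum_(i in s) smooth_norm mu (p.1 - p.2 i).

Let objective_ge0 p : feasible p -> 0 <= objective p.
Proof.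
move=> [Op pr Qp]; apply: le_trans (decoupled_min Op pr Qp) _.
by rewrite lerD2l; apply: ler_sum => i _; exact: smooth_norm_ge.
Qed.

Let objective_xbar : objective (xbar, fun=> xbar) = lam * (lam * #|s|%:R).
Proof.
rewrite /objective /= subrr ip0r normr0 expr0n mulr0 !add0r.
rewrite (eq_bigr (fun=> mu)); last by move=> i _; rewrite smooth_norm0.
by rewrite sumr_const -[LHS]mulr_natr /mu expr2 mulrA.
Qed.

Let objective_lsc l : feasible l -> forall e, 0 < e ->
  exists2 d, 0 < d & forall p, feasible p -> rho p l <= d ->
    objective l <= objective p + e.
Proof.
move=> _ e e0.
(* A one-sided Lipschitz constant of the objective at [l]. *)
pose M := `|A| + 2 * K * `|l.1 - xbar| + (#|s|%:R + #|s|%:R) + 1.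
have M0 : 0 < M.
  by rewrite ltr_wpDl// !addr_ge0// mulr_ge0// mulr_ge0.
exists (e / M); first exact: divr_gt0.
move=> p _ pl; have : rho p l * M <= e by rewrite -ler_pdivlMr.
suff : objective l <= objective p + rho p l * M by lra.
rewrite /objective.
have d0 : 0 <= rho p l by exact: le_trans (rho_fst p l).
have lp : `|l.1 - p.1| <= rho p l by rewrite distrC; exact: rho_fst.
have h1 : ip A (l.1 - xbar) <= ip A (p.1 - xbar) + rho p l * `|A|.
  rewrite -(subrKA p.1 l.1) [in leLHS]ipDr [leLHS]addrC lerD2l.
  by apply: le_trans (ip_le ip_norm _ _) _; rewrite mulrC ler_wpM2r.
have h2 : K * `|l.1 - xbar| ^+ 2 <=
    K * `|p.1 - xbar| ^+ 2 + rho p l * (2 * K * `|l.1 - xbar|).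
  have := ler_distD p.1 l.1 xbar.
  move: lp d0 (normr_ge0 (l.1 - xbar)) (normr_ge0 (p.1 - xbar)).
  move: (`|l.1 - xbar|) (`|p.1 - xbar|) (`|l.1 - p.1|) (rho p l) => a b c d.
  move=> cd d0 a0 b0 abc.
  have -> : d * (2 * K * a) = K * (d * (2 * a)) by ring.
  rewrite -mulrDr; apply: ler_wpM2l => //.
  by have [ab|ab] := leP a b; nra.
have h3 : \sum_(i in s) smooth_norm mu (l.1 - l.2 i) <=
    \sum_(i in s) smooth_norm mu (p.1 - p.2 i) + rho p l * (#|s|%:R + #|s|%:R).
  have -> : rho p l * (#|s|%:R + #|s|%:R) = \sum_(i in s) (rho p l + rho p l).
    by rewrite sumr_const -mulr_natr; ring.
  rewrite -big_split/=; apply: ler_sum => i si.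
  apply: le_trans (smooth_norm_lipschitz mu _ (p.1 - p.2 i)) _.
  rewrite lerD2l opprB [p.2 i - _]addrC addrACA; apply: le_trans (ler_normD _ _) _.
  by apply: lerD => //; rewrite addrC; exact: rho_snd.
rewrite /M; lra.
Qed.

(** At Ekeland's point, moving [y i] alone bounds the gradient of one smoothed
    norm, and moving [u] alone bounds the sum of all gradients. *)
Lemma fuzzy_multipliers : lam * #|s|%:R < r ->
  exists (u : X) (y g : I -> X), [/\ `|u - xbar| <= lam * #|s|%:R,
    forall i, i \in s -> `|y i - xbar| <= lam * #|s|%:R,
    forall i, `|g i| <= 1,
    forall i, i \in s -> eps_subdiff ip lam (indicator_fun (Q i)) (y i) (g i) &
    eps_subdiff ip lam (indicator_fun Om) u
      (- (A + 2 * K *: (u - xbar) + \sum_(i in s) g i))].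
Proof.
move=> small.
have feas0 : feasible (xbar, fun=> xbar).
  by split=> //=; rewrite subrr normr0 ltW.
have [[u y] [Ou ur Qy] [close opt]] := ekeland rho_refl rho_sym rho_tri
  rho_complete objective_lsc objective_ge0 lam_gt0 feas0.
rewrite /= in Ou ur Qy.
have rho_small : rho (xbar, fun=> xbar) (u, y) <= lam * #|s|%:R.
  rewrite -(ler_pM2l lam_gt0); move: close; rewrite objective_xbar.
  by apply: le_trans; rewrite lerDr; exact: objective_ge0.
have u_small : `|u - xbar| <= lam * #|s|%:R.
  by rewrite distrC; apply: le_trans rho_small;
    exact: (rho_fst (xbar, fun=> xbar) (u, y)).
pose g i := smooth_grad mu (u - y i).
exists u, y, g; split => //.
- move=> i si; rewrite distrC; apply: le_trans rho_small.
  exact: (rho_snd (xbar, fun=> xbar) (u, y) si).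
- by move=> i; exact: smooth_grad_le1.
- move=> i si.
  apply: (@eps_normal_quadratic _ _ _ _ _ _ _ (2 * mu)^-1 1) => //.
    exact: Qy.
  move=> z Qz _.
  pose y' j := if j == i then z else y j.
  have feas' : feasible (u, y').
    split=> //= j sj; rewrite /y'; case: eqP => [->//|_]; exact: Qy.
  have := opt _ feas'; rewrite /objective /rho /= subrr normr0 add0r.
  rewrite (bigD1 i)//= [X in _ <= _ + X + _](bigD1 i)//=.
  rewrite [X in _ <= _ + lam * X](bigD1 i)//=.
  rewrite [X in _ <= _ + (_ + X) + _](eq_bigr
    (fun j => smooth_norm mu (u - y j))); last first.
    by move=> j /andP[_ /negPf ji]; rewrite /y' ji.
  rewrite [X in _ <= _ + lam * (_ + X)]big1 => [|j /andP[_ /negPf ji]]; last first.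
    by rewrite /y' ji subrr normr0.
  rewrite addr0 {1 2}/y' eqxx.
  have := smooth_norm_upper ip_norm mu_gt0 (u - y i) (u - z); rewrite -/(g i).
  have -> : u - z - (u - y i) = - (z - y i) by rewrite !opprB [LHS]addrC subrKA.
  rewrite ipNr normrN (distrC (y i)); lra.
apply: (@eps_normal_quadratic _ _ _ _ _ _ _
  (K + #|s|%:R * (2 * mu)^-1) (r - lam * #|s|%:R)) => //; first by rewrite subr_gt0.
move=> z Oz zu.
have feas' : feasible (z, y).
  by split=> //=; have := ler_distD u z xbar; lra.
have := opt _ feas'; rewrite /objective /rho /=.
rewrite [X in _ <= _ + lam * (_ + X)]big1 => [|i _]; last by rewrite subrr normr0.
rewrite addr0 (distrC u z).
have hs : \sum_(i in s) smooth_norm mu (z - y i) <=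
    \sum_(i in s) smooth_norm mu (u - y i) + ip (\sum_(i in s) g i) (z - u)
    + #|s|%:R * (2 * mu)^-1 * `|z - u| ^+ 2.
  have -> : #|s|%:R * (2 * mu)^-1 * `|z - u| ^+ 2
      = \sum_(i in s) ((2 * mu)^-1 * `|z - u| ^+ 2).
    by rewrite sumr_const -mulrA mulr_natl.
  rewrite ip_suml -!big_split/=; apply: ler_sum => i _.
  have := smooth_norm_upper ip_norm mu_gt0 (u - y i) (z - y i).
  by rewrite opprB subrKA.
have hK : `|z - xbar| ^+ 2 = `|u - xbar| ^+ 2 + 2 * ip (u - xbar) (z - u)
    + `|z - u| ^+ 2.
  by rewrite -(sqnormD ip_norm) [u - _ + _]addrC subrKA.
have hA : ip A (z - xbar) = ip A (u - xbar) + ip A (z - u).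
  by rewrite -ipDr [u - _ + _]addrC subrKA.
rewrite ipNl !ipDl ipZl hK hA; lra.
Qed.

End Fuzzy.

(** The gradients in [u] converge weakly because the quadratic part tends to 0
    in norm and the others converge weakly by compactness. *)
Theorem exact_multipliers : exists b : I -> X,
  (forall i, i \in s -> normal_cone ip xbar (Q i) (b i) /\ `|b i| <= 1) /\
  normal_cone ip xbar Om (- (A + \sum_(i in s) b i)).
Proof.
have s0 : 0 < #|s|%:R + 1 :> R by rewrite ltr_wpDl.
(* Small enough for Ekeland's point to stay in the interior of the ball on
   which minimality is known. *)
pose rate := Num.min 1 (r / (2 * (#|s|%:R + 1))).
have rate0 : 0 < rate by rewrite lt_min ltr01 divr_gt0// mulr_gt0.
have rate1 : rate <= 1 by rewrite ge_min lexx.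
have rate_r : rate * #|s|%:R < r.
  have : rate <= r / (2 * (#|s|%:R + 1)) by rewrite ge_min lexx orbT.
  rewrite ler_pdivlMr ?mulr_gt0// => h.
  by have := r_gt0; have := ler0n R #|s|; nra.
pose lam k : R := rate * k.+1%:R^-1.
have lam0 k : 0 < lam k by rewrite mulr_gt0// invr_gt0.
have lam_le j k : (j <= k)%N -> lam k <= j.+1%:R^-1.
  move=> jk; apply: (@le_trans _ _ (k.+1%:R^-1)).
    by rewrite ler_piMl// invr_ge0.
  by rewrite lef_pV2 ?posrE// ler_nat ltnS.
have /choice[z Hz] : forall k, exists z : X * (I -> X) * (I -> X),
    [/\ `|z.1.1 - xbar| <= lam k * #|s|%:R,
    forall i, i \in s -> `|z.1.2 i - xbar| <= lam k * #|s|%:R,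
    forall i, `|z.2 i| <= 1,
    forall i, i \in s ->
      eps_subdiff ip (lam k) (indicator_fun (Q i)) (z.1.2 i) (z.2 i) &
    eps_subdiff ip (lam k) (indicator_fun Om) z.1.1
      (- (A + 2 * K *: (z.1.1 - xbar) + \sum_(i in s) z.2 i))].
  move=> k; have [|u [y [g H]]] := @fuzzy_multipliers (lam k) (lam0 k).
    apply: le_lt_trans rate_r; rewrite ler_wpM2r// ler_piMr ?(ltW rate0)//.
    by rewrite invf_le1 ?ler1n.
  by exists (u, y, g).
have gB i k : `|(z k).2 i| <= 1 by have [_ _] := Hz k.
have [b [phi [phik Hb]]] :=
  weak_sequential_compactness ip_norm (g := fun i k => (z k).2 i) gB.
have to_xbar (v : nat -> X) :
    (forall k, `|v k - xbar| <= lam k * #|s|%:R) -> v \o phi @ \oo --> xbar.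
  move=> hv; apply/seq_cvgP => e e0.
  have [N HN] := inv_succ_eventually_le (divr_gt0 e0 s0).
  exists N => k Nk; apply: le_trans (hv _) _.
  have := HN k Nk; rewrite ler_pdivlMr// => h; apply: le_trans h.
  apply: ler_pM => //; first exact/ltW/lam0.
    exact: lam_le.
  by rewrite lerDl.
have u_cvg : (fun k => (z (phi k)).1.1) @ \oo --> xbar.
  by apply: (to_xbar (fun k => (z k).1.1)) => k; have [] := Hz k.
exists b; split.
  move=> i si; have [b1 weak_b] := Hb i; split=> //.
  apply: (@limiting_normal_intro _ _ _ _ _ (fun k => (z (phi k)).1.2 i)
    (fun k => (z (phi k)).2 i)) => //.
  - exact: Q_xbar.
  - by apply: (to_xbar (fun k => (z k).1.2 i)) => k; have [_ + _ _ _] := Hz k; apply.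
  - move=> k; apply: (eps_normal_le (lam_le _ _ (phik k))).
    by have [_ _ _ + _] := Hz (phi k); apply.
apply: (@limiting_normal_intro _ _ _ _ _ (fun k => (z (phi k)).1.1)
  (fun k => - (A + 2 * K *: ((z (phi k)).1.1 - xbar)
               + \sum_(i in s) (z (phi k)).2 i))) => //.
  move=> k; apply: (eps_normal_le (lam_le _ _ (phik k))).
  by have [_ _ _ _] := Hz (phi k).
move=> v; rewrite ipNl ipDl ip_suml -[ip A v]addr0 -[X in _ + X + _](mulr0 (2 * K)).
rewrite (_ : (fun k => _) = (fun k => - (ip A v
    + (2 * K) * ip ((z (phi k)).1.1 - xbar) v
    + \sum_(i in s) ip ((z (phi k)).2 i) v))); last first.
  by apply/funext => k; rewrite ipNl 2!ipDl ipZl ip_suml.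
apply: cvgN; apply: cvgD; last first.
  apply: (@cvg_sum R R^o _ _ _ (fun i k => ip ((z (phi k)).2 i) v)
    (fun i => ip (b i) v)) => i _.
  exact: (Hb i).2.
apply: cvgD; first exact: cvg_cst.
apply: cvgMl_tmp; rewrite -(ip0l ip v) -(subrr xbar).
apply: (ip_cvg ip_norm); apply: cvgB => //; exact: cvg_cst.
Qed.

End Multipliers.

(** * Supports and majorants of the distance function *)

Section ConvexSupport.
Context {R : realType} {X : completeNormedModType R}.
Variable ip : {dot X for idfun}.
Hypothesis ip_norm : forall x : X, ip x x = `|x| ^+ 2.
Implicit Types (Q : set X) (x y l : X).

(** The uniform boundedness principle, the inner products with members of the
    sequence being pointwise bounded linear functionals. *)
Lemma weak_cvg_bounded (g : nat -> X) l : weak_cvg ip g l ->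
  exists M, forall k, `|g k| <= M.
Proof.
move=> gl.
have [||M HM] := @Banach_Steinhauss R X R^o (range (fun k => ip (g k) : X -> R^o))
  _ _ 1.
- move=> _ [k _ <-]; split.
    move=> r; exists (`|g k| * r) => x xr.
    by apply: le_trans (ip_abs ip_norm _ _) _; rewrite ler_wpM2l.
  by move=> a u v; rewrite ipDr ipZr.
- move=> v; have [N HN] := (seq_cvgP _ _).1 (gl v) 1 ltr01.
  exists (`|ip l v| + 1 + \sum_(j < N) `|ip (g j) v|) => _ [k _ <-].
  have [Nk|kN] := leqP N k.
    apply: ler_wpDr; first exact: sumr_ge0.
    by have := HN k Nk; have := ler_normD (ip (g k) v - ip l v) (ip l v);
      rewrite subrK; lra.
  rewrite (bigD1 (Ordinal kN))//= addrCA lerDl.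
  by rewrite addr_ge0// ?sumr_ge0// addr_ge0.
exists M => k; have [->|g0] := eqVneq (g k) 0.
  by rewrite normr0; have := HM _ (imageT _ k) 0; rewrite !normr0 ip0r normr0; exact.
have n0 : 0 < `|g k| by rewrite normr_gt0.
have := HM _ (imageT _ k) (`|g k|^-1 *: g k).
rewrite normrZ normfV normr_id mulVf ?gt_eqF// => /(_ (lexx _)).
rewrite ipZr ip_norm expr2 mulrA mulVf ?gt_eqF// mul1r normr_id//.
Qed.

(** The base points vary with the approximate normals, so their pairing passes
    to the limit only because weakly convergent normals are bounded. *)
Lemma normal_cone_convex Q x l y : convex_set Q -> normal_cone ip x Q l ->
  Q y -> ip l (y - x) <= 0.
Proof.
move=> cvQ [_ [xk [eps [g [xkx _ [_ eps0] gk gl]]]]] Qy.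
have [M gM] := weak_cvg_bounded gl.
have M0 : 0 <= M by exact: le_trans (gM 0%N).
apply: (@le0_of_small_multiples _ _ (`|y - x| + 2 + M)) => t t0 t1.
have [N1 H1] := (seq_cvgP _ _).1 xkx t t0.
have [N2 H2] := (seq_cvgP _ _).1 eps0 t t0.
have [N3 H3] := (seq_cvgP _ _).1 (gl (y - x)) t t0.
pose k := maxn N1 (maxn N2 N3).
have := H1 k (leq_maxl _ _).
have /H2 : (N2 <= k)%N by rewrite /k maxnCA leq_maxl.
have /H3 : (N3 <= k)%N by rewrite /k maxnA leq_maxr.
have [e0 nk] := gk k; have hy := eps_normal_convex cvQ nk Qy.
rewrite subr0 (ger0_norm e0) ler_norml => /andP[h3 _] het hxt.
have : ip (g k) (y - x) = ip (g k) (y - xk k) + ip (g k) (xk k - x).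
  by rewrite -ipDr subrKA.
have := ip_le ip_norm (g k) (xk k - x).
have : `|g k| * `|xk k - x| <= M * t by apply: ler_pM.
have : eps k * `|y - xk k| <= t * (`|y - x| + 1).
  apply: ler_pM => //.
  by have := ler_distD x y (xk k); rewrite (distrC x (xk k)); lra.
lra.
Qed.

(** The projection inequality says that [a], the unit vector from [w] to [x],
    has nonpositive product with [z - w] for [z] in the set; the rest is
    [<a, y - z> <= |y - z|]. *)
Lemma dist_supported_by_projection Q x w y : convex_set Q -> proj x Q w ->
  0 < dist x Q ->
  dist x Q + ip ((dist x Q)^-1 *: (x - w)) (y - x) <= dist y Q.
Proof.
move=> cvQ pw d0; have [Qw xw] := pw.
apply: dist_glb => [|z Qz]; first by exists w.
have h := proj_variational ip_norm cvQ pw Qz.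
set a := _ *: _; have a1 : `|a| = 1.
  by rewrite normrZ xw normfV gtr0_norm// mulVf// gt_eqF.
have haz : ip a (z - w) <= 0.
  by rewrite ipZl pmulr_rle0// invr_gt0.
have hax : ip a (x - w) = dist x Q.
  by rewrite ipZl ip_norm xw expr2 mulrA mulVf ?mul1r// gt_eqF.
have hyz : ip a (y - z) <= `|y - z|.
  by apply: le_trans (ip_le ip_norm _ _) _; rewrite a1 mul1r.
have : ip a (y - x) = ip a (y - z) + ip a (z - w) - ip a (x - w).
  by rewrite -ipDr -ipBr subrKA opprB subrKA.
lra.
Qed.

Lemma dist_supported_by_normal Q x l y : convex_set Q -> Q x ->
  normal_cone ip x Q l -> `|l| <= 1 -> ip l (y - x) <= dist y Q.
Proof.
move=> cvQ Qx Nl l1; apply: dist_glb => [|z Qz]; first by exists x.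
have h := normal_cone_convex cvQ Nl Qz.
have hyz : ip l (y - z) <= `|y - z|.
  by apply: le_trans (ip_le ip_norm _ _) _; rewrite ler_piMl.
have : ip l (y - x) = ip l (y - z) + ip l (z - x) by rewrite -ipDr subrKA.
lra.
Qed.

(** The distance to the fixed point [w] is a majorant that is exact at [x];
    bounding it by its square, through [t <= (d^2 + t^2) / (2 d)], makes it
    quadratic. *)
Lemma dist_quadratic_majorant Q x w u : proj x Q w -> 0 < dist x Q ->
  dist u Q <= dist x Q + ip ((dist x Q)^-1 *: (x - w)) (u - x)
              + (2 * dist x Q)^-1 * `|u - x| ^+ 2.
Proof.
move=> [Qw xw] d0; apply: le_trans (dist_le u Qw) _.
have h : `|u - w| ^+ 2 = dist x Q ^+ 2 + 2 * ip (x - w) (u - x) + `|u - x| ^+ 2.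
  by rewrite -xw -(sqnormD ip_norm) [x - w + _]addrC subrKA.
rewrite ipZl.
have -> : dist x Q + (dist x Q)^-1 * ip (x - w) (u - x)
    + (2 * dist x Q)^-1 * `|u - x| ^+ 2
  = (dist x Q ^+ 2 + `|u - w| ^+ 2) / (2 * dist x Q).
  by rewrite h; field; rewrite gt_eqF.
rewrite ler_pdivlMr ?mulr_gt0//.
have := sqr_ge0 (`|u - w| - dist x Q); rewrite sqrrB; lra.
Qed.

End ConvexSupport.

(** * Optimality conditions *)

Section Optimality.
Context {R : realType} {X : completeNormedModType R}.
Variable ip : {dot X for idfun}.
Hypothesis ip_norm : forall x : X, ip x x = `|x| ^+ 2.
Variables (n : nat) (Om : set X) (Oms : 'I_n -> set X).
Hypothesis Om_closed : closed Om.
Hypothesis Oms_neq0 : forall i, Oms i !=set0.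
Hypothesis Oms_closed : forall i, closed (Oms i).
Implicit Types (x : X) (a : 'I_n -> X).

Lemma idxI_mem x i : i \in idxI Oms x -> Oms i x.
Proof. by rewrite inE => /set_mem. Qed.

Lemma idxJ_notin x i : i \in idxJ Oms x -> ~ Oms i x.
Proof. by rewrite inE => h Ox; move: h; rewrite mem_set. Qed.

Lemma idxJ_dist_gt0 x i : i \in idxJ Oms x -> 0 < dist x (Oms i).
Proof. by move=> /idxJ_notin; apply: dist_gt0. Qed.

Lemma sum_idx (V : nmodType) x (F : 'I_n -> V) :
  \sum_(i < n) F i = \sum_(i in idxJ Oms x) F i + \sum_(i in idxI Oms x) F i.
Proof.
rewrite (bigID (mem (idxJ Oms x)))/=; congr (_ + _).
by apply: eq_bigl => i; rewrite !inE negbK.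
Qed.

Lemma Aset_idxJ x i v : i \in idxJ Oms x -> Aset Oms ip i x v ->
  exists2 w, proj x (Oms i) w & v = (dist x (Oms i))^-1 *: (x - w).
Proof.
by rewrite inE /Aset => /negPf ->  [w pw <-]; exists w.
Qed.

Lemma cost_decoupled_majorant a x u (y : 'I_n -> X) :
  (forall i, i \in idxJ Oms x -> Aset Oms ip i x (a i)) ->
  (forall i, i \in idxI Oms x -> Oms i (y i)) ->
  cost Oms u <= cost Oms x + (ip (\sum_(i in idxJ Oms x) a i) (u - x)
    + (\sum_(i in idxJ Oms x) (2 * dist x (Oms i))^-1) * `|u - x| ^+ 2
    + \sum_(i in idxI Oms x) `|u - y i|).
Proof.
move=> Ha Hy; rewrite /cost !(sum_idx x).
rewrite [X in _ <= _ + X + _]big1 => [|i /idxI_mem]; last exact: dist_mem.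
rewrite addr0 addrA lerD//; last first.
  by apply: ler_sum => i /Hy; exact: dist_le.
rewrite ip_suml mulr_suml -!big_split/=; apply: ler_sum => i iJ.
have [w pw ->] := Aset_idxJ iJ (Ha i iJ).
by rewrite addrA; apply: dist_quadratic_majorant => //; exact: idxJ_dist_gt0.
Qed.

Lemma local_optimal_decoupled a x : local_optimal Om Oms x ->
  (forall i, i \in idxJ Oms x -> Aset Oms ip i x (a i)) ->
  exists2 r, 0 < r & forall u (y : 'I_n -> X), Om u -> `|u - x| <= r ->
    (forall i, i \in idxI Oms x -> Oms i (y i)) ->
    0 <= ip (\sum_(i in idxJ Oms x) a i) (u - x)
      + (\sum_(i in idxJ Oms x) (2 * dist x (Oms i))^-1) * `|u - x| ^+ 2
      + \sum_(i in idxI Oms x) `|u - y i|.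
Proof.
move=> [_ /nbhs_normP[r /= r0 hr]] Ha.
exists (r / 2) => [|u y Ou ur Hy]; first exact: divr_gt0.
have : cost Oms x <= cost Oms u.
  by apply: hr => //=; rewrite distrC; apply: le_lt_trans ur _; lra.
by move=> /le_trans /(_ (cost_decoupled_majorant u Ha Hy)); rewrite lerDl.
Qed.

Lemma curvature_ge0 x :
  0 <= \sum_(i in idxJ Oms x) (2 * dist x (Oms i))^-1.
Proof.
by apply: sumr_ge0 => i _; rewrite invr_ge0 mulr_ge0// dist_ge0.
Qed.

Theorem local_optimal_stationary a x : local_optimal Om Oms x ->
  (forall i, i \in idxJ Oms x -> Aset Oms ip i x (a i)) ->
  stationary Om Oms ip a x.
Proof.
move=> loc Ha; have [r r0 dec] := local_optimal_decoupled loc Ha.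
have [b [Hb HN]] := exact_multipliers ip_norm Om_closed Oms_closed loc.1
  (@idxI_mem x) (curvature_ge0 x) r0 dec.
exists (\sum_(i in idxI Oms x) b i).
  exists b => // i iI; rewrite /Aset mem_set; last exact: idxI_mem.
  exact: Hb.
by eexists; [exact: HN|rewrite opprD addrCA subrr addr0].
Qed.

Lemma local_optimal_regular a x : local_optimal Om Oms x ->
  (forall i, i \in idxJ Oms x -> Aset Oms ip i x (a i)) ->
  idxI Oms x = finset.set0 ->
  regular_normal_cone ip x Om (- \sum_(i < n) a i).
Proof.
move=> loc Ha I0; have [r r0 dec] := local_optimal_decoupled loc Ha.
apply: (@eps_normal_quadratic _ _ _ _ _ _ _
  (\sum_(i in idxJ Oms x) (2 * dist x (Oms i))^-1) r loc.1 r0) => u Ou ur.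
have noI i : i \in idxI Oms x -> Oms i u by rewrite I0 inE.
have := dec u (fun=> u) Ou ur noI; rewrite I0 big_set0 addr0.
by rewrite (sum_idx x a) I0 big_set0 addr0 mul0r add0r ipNl; lra.
Qed.

(** The sum of the supports of the individual distances has slope [- c], where
    [c] is normal to the convex constraint set. *)
Theorem stationary_global_optimal a x : convex_set Om ->
  (forall i, convex_set (Oms i)) -> Om x ->
  (forall i, i \in idxJ Oms x -> Aset Oms ip i x (a i)) ->
  stationary Om Oms ip a x -> global_optimal Om Oms x.
Proof.
move=> cvOm cvOms Ox Ha [_ [b Hb ->] [c Nc bc]]; split=> // y Oy.
rewrite /cost !(sum_idx x).
rewrite [X in _ + X <= _]big1 => [|i /idxI_mem]; last exact: dist_mem.
have hI : ip (\sum_(i in idxI Oms x) b i) (y - x) <=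
    \sum_(i in idxI Oms x) dist y (Oms i).
  rewrite ip_suml; apply: ler_sum => i iI.
  have := Hb i iI; rewrite /Aset mem_set; last exact: idxI_mem.
  move=> [Nb b1]; apply: (dist_supported_by_normal ip_norm) => //.
  exact: idxI_mem.
have hJ : \sum_(i in idxJ Oms x) dist x (Oms i)
    + ip (\sum_(i in idxJ Oms x) a i) (y - x) <=
    \sum_(i in idxJ Oms x) dist y (Oms i).
  rewrite ip_suml -big_split/=; apply: ler_sum => i iJ.
  have [w pw ->] := Aset_idxJ iJ (Ha i iJ).
  by apply: dist_supported_by_projection => //; exact: idxJ_dist_gt0.
have hc := normal_cone_convex ip_norm cvOm Nc Oy.
have : ip (\sum_(i in idxI Oms x) b i) (y - x) + ip c (y - x)
    = - ip (\sum_(i in idxJ Oms x) a i) (y - x).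
  by rewrite -ipDl bc ipNl.
lra.
Qed.

Lemma Aset_convex_singleton x i : convex_set (Oms i) -> i \in idxJ Oms x ->
  exists v, Aset Oms ip i x = [set v].
Proof.
move=> cvi iJ; have [w pw] := proj_exists ip_norm x (@Oms_closed i) cvi (Oms_neq0 i).
exists ((dist x (Oms i))^-1 *: (x - w)); apply/seteqP; split=> v.
  by move=> /(Aset_idxJ iJ)[w' pw' ->]; rewrite (proj_unique ip_norm cvi pw pw').
by move=> ->; rewrite /Aset; move: iJ; rewrite inE => /negPf ->; exists w.
Qed.

End Optimality.

Theorem theorem3p3 (R : realType) (X : completeNormedModType R)
  (ip : {dot X for idfun}) (ip_norm : forall x : X, ip x x = `|x| ^+ 2)
  (n : nat) (n_ge2 : (2 <= n)%N)
  (Om : set X) (Oms : 'I_n -> set X)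
  (Om_neq0 : Om !=set0) (Om_closed : closed Om)
  (Oms_neq0 : forall i, Oms i !=set0) (Oms_closed : forall i, closed (Oms i)) :
  (forall xbar : X,
     local_optimal Om Oms xbar ->
     (forall i, i \in idxJ Oms xbar -> proj xbar (Oms i) !=set0) ->
     forall a : 'I_n -> X,
       (forall i, i \in idxJ Oms xbar -> Aset Oms ip i xbar (a i)) ->
       stationary Om Oms ip a xbar /\
       (idxI Oms xbar = finset.set0 ->
        regular_normal_cone ip xbar Om (- \sum_(i < n) a i)))
  /\
  (convex_set Om -> (forall i, convex_set (Oms i)) ->
   forall xbar : X, Om xbar ->
     exists a : 'I_n -> X,
       (forall i, i \in idxJ Oms xbar -> Aset Oms ip i xbar = [set a i]) /\
       (stationary Om Oms ip a xbar <-> global_optimal Om Oms xbar)).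
Proof.
split=> [xbar loc _ a Ha|cvOm cvOms xbar Oxbar].
  by split; [exact: local_optimal_stationary|exact: local_optimal_regular].
have /choice[a Ha] : forall i, exists v, i \in idxJ Oms xbar ->
    Aset Oms ip i xbar = [set v].
  move=> i; have [iJ|iJ] := boolP (i \in idxJ Oms xbar); last by exists 0.
  by have [v Hv] := Aset_convex_singleton ip_norm Oms_neq0 Oms_closed (cvOms i) iJ;
    exists v.
have aA i : i \in idxJ Oms xbar -> Aset Oms ip i xbar (a i).
  by move=> /Ha ->.
exists a; split=> //; split; first exact: stationary_global_optimal.
move=> [_ opt]; apply: local_optimal_stationary => //.
by split=> //; near=> u; exact: opt.
Unshelve. all: by end_near. Qed.
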